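(* Let $\Omega\subseteq\mathbb{T}$ be measurable, with positive finite measure $T=|\Omega|_{\mathbb{T}}$ and essential arc diameter $D=D_{\mathbb{T}}(\Omega)$, and let $P(z)=\sum_{k=0}^n a_kz^k\in\mathbb{C}[z]$ be a polynomial of degree $n\ge1$. Assume $nD\le2\pi$. Let $P^*(z)=\sum_{k=0}^n a_k^*z^k$, where $(a_0^*,\dots,a_n^* )$ is a permutation of $(|a_0|,\dots,|a_n|)$ satisfying $$a^*_{\lceil n/2\rceil}\ge a^*_{\lfloor n/2\rfloor}\ge a^*_{\lceil n/2\rceil+1}\ge a^*_{\lfloor n/2\rfloor-1}\ge\cdots\qquad\text{if } n\text{ is odd},$$ $$a^*_{n/2}\ge a^*_{n/2+1}\ge a^*_{n/2-1}\ge a^*_{n/2+2}\ge a^*_{n/2-2}\ge\cdots\qquad\text{if } n\text{ is even}.$$ Then $$\int_\Omega|P(z)|^2\,\mathrm{dm}(z)\le\int_{I_T}|P^*(z)|^2\,\mathrm{dm}(z).$$ In particular, $c_\Omega(P)\le c_{I_T}(P^* )$.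
   Context: $\mathbb{T}=\{z\in\mathbb{C}:|z|=1\}$ is the unit circle, and $\mathrm{dm}$ is arc-length measure on $\mathbb{T}$, normalized so that $\int_{\mathbb{T}}\mathrm{dm}=2\pi$; $|\Omega|_{\mathbb{T}}=\int_\Omega\mathrm{dm}(z)$. For $0<T\le2\pi$, $I_T=\{e^{i\theta}:-T/2\le\theta\le T/2\}$ is the centered arc of measure $T$. The essential arc diameter is $D_{\mathbb{T}}(\Omega)=\inf\{D\in[0,2\pi]:\Omega\text{ is contained, up to a null set, in a circular arc of length }D\}$. For measurable $\Omega\subseteq\mathbb{T}$ and a nonzero polynomial $P$, the concentration is $c_\Omega(P)=\int_\Omega|P(z)|^2\,\mathrm{dm}(z)\big/\int_{\mathbb{T}}|P(z)|^2\,\mathrm{dm}(z)$. The chains of inequalities defining the arrangement continue until all indices $0,\dots,n$ have been used. *)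

(* Defs.v *)
From HB Require Import structures.
From mathcomp Require Import all_boot all_order all_algebra.
From mathcomp Require Import complex.
From mathcomp Require Import all_classical all_reals all_analysis.

Set Implicit Arguments.
Unset Strict Implicit.
Unset Printing Implicit Defensive.
Import Order.TTheory GRing.Theory Num.Theory.

Local Open Scope classical_set_scope.
Local Open Scope ring_scope.
Local Open Scope complex_scope.

Definition circle (R : realType) := {z : R[i] | `|z| == 1}.

Lemma norm_expi (R : realType) (t : R) : `|cos t +i* sin t| == 1.
Proof. by rewrite normc_def cos2Dsin2 sqrtr1. Qed.

Definition expi {R : realType} (t : R) : circle R :=
  exist _ (cos t +i* sin t) (norm_expi t).

Section circle_measurable.
Variable R : realType.

HB.instance Definition _ := Choice.on (circle R).
HB.instance Definition _ := isPointed.Build (circle R) (expi 0).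

(* The type of reals carrying the Lebesgue (not merely Borel) sigma-algebra. *)
Definition lebesgueType : measurableType _ :=
  caratheodory_type ((wlength (@idfun R))^*)%mu.

(* The branch ]-pi, pi] of the angle; [expi] maps it bijectively onto the
   circle. *)
Definition angle_range : set lebesgueType := `]- pi, pi]%classic.

(* Lebesgue measurable subsets of the circle: those whose set of angles is
   Lebesgue measurable. *)
Definition circle_measurable : set (set (circle R)) :=
  image_set_system angle_range expi measurable.

Lemma measurable_angle_range : measurable angle_range.
Proof.
apply: sub_caratheodory.
exact: (measurable_itv (`]- pi, pi] : interval R)).
Qed.

Let circle_sigma_algebra : sigma_algebra setT circle_measurable.
Proof.
apply: sigma_algebra_image; split=> //.
- by move=> A mA; apply: measurableD => //; exact: measurable_angle_range.
- by move=> F mF; exact: bigcupT_measurable.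
Qed.

Let circle_measurable0 : circle_measurable set0.
Proof. by case: circle_sigma_algebra. Qed.

Let circle_measurableC A : circle_measurable A -> circle_measurable (~` A).
Proof. by case: circle_sigma_algebra => _ + _ => /[apply]; rewrite setTD. Qed.

Let circle_measurable_bigcup (F : (set (circle R))^nat) :
  (forall i, circle_measurable (F i)) -> circle_measurable (\bigcup_i F i).
Proof. by case: circle_sigma_algebra => _ _; apply. Qed.

HB.instance Definition _ :=
  @isMeasurable.Build default_measure_display (circle R) circle_measurable
    circle_measurable0 circle_measurableC circle_measurable_bigcup.

End circle_measurable.

Section arc_length.
Variable R : realType.
Local Open Scope ereal_scope.

Definition arc_length (A : set (circle R)) : \bar R :=
  @completed_lebesgue_measure R (@angle_range R `&` expi @^-1` A).

Let arc_length0 : arc_length set0 = 0.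
Proof. by rewrite /arc_length preimage_set0 setI0 measure0. Qed.

Let arc_length_ge0 A : 0 <= arc_length A.
Proof. exact: measure_ge0. Qed.

Let arc_length_sigma_additive : semi_sigma_additive arc_length.
Proof.
move=> F mF tF mUF; rewrite /arc_length preimage_bigcup setI_bigcupr.
apply: measure_semi_sigma_additive.
- exact: mF.
- apply/trivIsetP => i j _ _ ij; apply/seteqP; split=> // t [[_ Fit] [_ Fjt]].
  by move/trivIsetP : tF => /(_ i j I I ij)/disjoints_subset/(_ _ Fit); exact.
- by rewrite -setI_bigcupr -preimage_bigcup; exact: mUF.
Qed.

HB.instance Definition _ := isMeasure.Build _ _ _ arc_length
  arc_length0 arc_length_ge0 arc_length_sigma_additive.

End arc_length.

Lemma arc_lengthT (R : realType) :
  arc_length [set: circle R] = (2 * pi)%:E.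
Proof.
rewrite /arc_length preimage_setT setIT /completed_lebesgue_measure.
rewrite /completed_lebesgue_stieltjes_measure /completed_measure_extension.
rewrite /angle_range.
have -> := @measurable_mu_extE _ _ _ (wlength (@idfun R)) `]- pi, pi]%classic;
  last exact: is_ocitv.
transitivity (wlength (@idfun R) [set` (`]- pi, pi]%R : interval R)]);
  first by [].
by rewrite wlength_itv /= lte_fin gtrN ?pi_gt0 //= opprK mulr_natl mulr2n.
Qed.

Section concentration.
Variable R : realType.
Implicit Types (P : {poly R[i]}) (A : set (circle R)).

Definition arc (a L : R) : set (circle R) := [set expi t | t in `[a, a + L]].

Definition centered_arc (T : R) : set (circle R) :=
  [set expi t | t in `[- (T / 2), T / 2]].

Definition ess_arc_diam A : R :=
  inf [set D : R | 0 <= D <= 2 * pi /\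
    exists a, (@arc_length R).-negligible (A `\` arc a D)].

Definition energy A P : \bar R :=
  (\int[@arc_length R]_(z in A) (Normc.normc P.[val z] ^+ 2)%:E)%E.

Definition concentration A P : R := fine (energy A P) / fine (energy setT P).

(* n odd:  b_c >= b_f >= b_(c+1) >= b_(f-1) >= ... >= b_n >= b_0 with
   c = uphalf n (ceiling of n/2) and f = n./2 (floor of n/2);
   n even: b_m >= b_(m+1) >= b_(m-1) >= ... >= b_n >= b_0 with m = n./2.
   In each case the two conditions are the alternate links of the chain. *)
Definition arranged (n : nat) (b : nat -> R) : Prop :=
  if odd n then
    (forall i, (i <= n./2)%N -> b (n./2 - i)%N <= b (uphalf n + i)%N) /\
    (forall i, (i < n./2)%N -> b (uphalf n + i.+1)%N <= b (n./2 - i)%N)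
  else
    (forall i, (i < n./2)%N -> b (n./2 + i.+1)%N <= b (n./2 - i)%N) /\
    (forall i, (i < n./2)%N -> b (n./2 - i.+1)%N <= b (n./2 + i.+1)%N).

End concentration.

(* Main.v *)
Require Import Defs.
From mathcomp Require Import all_boot all_order all_algebra.
From mathcomp Require Import complex.
From mathcomp Require Import zify ring lra.
From mathcomp Require Import all_classical all_reals all_analysis.
From mathcomp Require Import measurable_realfun.
Set Implicit Arguments.
Unset Strict Implicit.
Unset Printing Implicit Defensive.
Import Order.TTheory GRing.Theory Num.Theory.
Import numFieldNormedType.Exports.
Local Open Scope classical_set_scope.
Local Open Scope ring_scope.
Local Open Scope complex_scope.

(** Write a_k for the coefficients of P and expand |P(e^(it))|^2 as the double
    sum of a_j conj(a_k) e^(i(j-k)t).  Integrating over Omega, the pair (j, k)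
    contributes the real part of a_j conj(a_k) times the (j-k)-th Fourier
    coefficient of Omega, and the theorem follows from two extremal facts.

    - Bathtub ([bathtub], [wave_gain]).  Put m = |j - k| <= n.  As n D <= 2 pi,
      Omega lies in an arc no longer than a period 2 pi / m of a wave of
      frequency m and amplitude |a_j| |a_k|.  Within one period, a set of
      measure T catches the most of such a wave when it is the interval of
      length T around a crest.  So the contribution is at most
      |a_j| |a_k| g(m), where g(m), called [gain], is the integral of cos(m t)
      over [-T/2, T/2].

    - Rearrangement ([riesz_rearrangement]).  As n T <= n D <= 2 pi, the
      sequence g is nonincreasing on 0, ..., n.  By the discrete Riesz
      rearrangement inequality, the sum of |a_j| |a_k| g(|j - k|) does not
      decrease when the moduli are rearranged symmetrically decreasingly
      around n/2, that is, when they are replaced by the a*_k.  The sum of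
      a*_j a*_k g(|j - k|) is exactly the energy of P* on I_T.

    The bathtub bound is proved through the function max(w - t, 0), with w the
    wave and t its level at the end points of the optimal interval.  It is
    nonnegative and periodic, so its integral over Omega is at most its
    integral over one period, which is that of w - t over an interval of
    length T.  Only an arc slightly longer than D is known to contain Omega;
    the excess costs an arbitrarily small error.

    For the rearrangement, both sequences are decomposed into their level sets,
    whose indicator functions are compared by pairs.  The levels of P* are
    intervals with almost equal centres, and the sum of g(|i - j|) over two
    finite sets of given sizes is largest for such intervals
    ([riesz_interval]): the pairs that involve the least element of one of the
    sets have pairwise distinct differences, and they can be peeled off by
    induction.

    For the concentrations, the waves of nonzero frequency integrate to zero
    over the circle, so P and P* have the same total energy ([energyT]). *)

(** * Discrete Riesz rearrangement *)

(** The differences i - j of the pairs taken from x :: s and y :: t that involve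
    x or y.  When x and y are the least elements, these differences are strictly
    monotone along the hook-shaped path that the pairs form, hence distinct. *)
Definition hook (x y : nat) (s t : seq nat) : seq int :=
  [seq x%:Z - j%:Z | j <- y :: t] ++ [seq i%:Z - y%:Z | i <- s].

Section Rearrangement.
Variable R : realDomainType.
Variable g : nat -> R.
Hypothesis g_dec : forall i j, (i <= j)%N -> g j <= g i.

(** A sum of values of a function that decreases with the distance to 0 is
    largest on the integers closest to 0.  Subtracting g h from every term makes
    the terms nonnegative on t and nonpositive off t. *)
Lemma sum_le_centered (h : nat) (s t : seq int) :
  uniq s -> uniq t -> size s = size t ->
  {in t, forall m, (`|m| <= h)%N} ->
  (forall m, m \notin t -> (h <= `|m|)%N) ->
  \sum_(m <- s) g `|m|%N <= \sum_(m <- t) g `|m|%N.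
Proof.
move=> us ut sz tle tge.
have sum_shift (u : seq int) : \sum_(m <- u) g `|m|%N =
    \sum_(m <- u) (g `|m|%N - g h) + g h *+ size u.
  by rewrite sumrB big_const_seq count_predT iter_addr_0 subrK.
rewrite sum_shift [leRHS]sum_shift sz lerD2r.
apply: (@le_trans _ _ (\sum_(m <- s | m \in t) (g `|m|%N - g h))).
  rewrite [leRHS]big_mkcond /=; apply: ler_sum => m _.
  by case: ifPn => // /tge/g_dec; rewrite subr_le0.
rewrite -big_filter (perm_big [seq m <- t | m \in s]) /=; last first.
  apply: uniq_perm; rewrite ?filter_uniq// => m.
  by rewrite !mem_filter andbC.
rewrite big_filter big_mkcond /= !big_seq; apply: ler_sum => m mt.
by case: ifPn => // _; rewrite subr_ge0 g_dec// tle.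
Qed.

(** Riesz rearrangement for sets.  Removing the least element of both sets
    removes a hook, and leaves the distance between the centres of the two
    intervals unchanged.  The hook of the given sets consists of as many distinct
    integers as the hook of the two intervals, and the latter is a run of
    integers centered within 1/2 of 0, so it has the larger sum. *)
Lemma riesz_interval (s t : seq nat) (a b : nat) :
  sorted ltn s -> sorted ltn t ->
  (2 * a + size s <= (2 * b + size t).+1)%N ->
  (2 * b + size t <= (2 * a + size s).+1)%N ->
  \sum_(i <- s) \sum_(j <- t) g `|i%:Z - j%:Z|%N <=
  \sum_(i <- iota a (size s)) \sum_(j <- iota b (size t)) g `|i%:Z - j%:Z|%N.
Proof.
elim: s t a b => [|x s IH] t a b; first by rewrite !big_nil.
case: t => [|y t] srt_s srt_t ab ba /=.
  by rewrite !big1// => i _; rewrite big_nil.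
have peel (x' y' : nat) (s' t' : seq nat) :
  \sum_(i <- x' :: s') \sum_(j <- y' :: t') g `|i%:Z - j%:Z|%N =
  \sum_(m <- hook x' y' s' t')
    g `|m|%N + \sum_(i <- s') \sum_(j <- t') g `|i%:Z - j%:Z|%N.
  rewrite big_cons /hook big_cat !big_map /= -addrA; congr (_ + _).
  by rewrite -big_split /=; apply: eq_bigr => i _; rewrite big_cons.
rewrite !peel; apply: lerD; last first.
  apply: IH; [exact: path_sorted srt_s|exact: path_sorted srt_t| |].
    by move: ab => /=; lia.
  by move: ba => /=; lia.
have hook_uniq (x' y' : nat) (s' t' : seq nat) : path ltn x' s' -> path ltn y' t' ->
   uniq (hook x' y' s' t').
  move=> ps pt; rewrite /hook cat_uniq !map_inj_uniq; last 2 first.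
  - by move=> i j; lia.
  - by move=> i j; lia.
  have -> := sorted_uniq ltn_trans ltnn (pt : sorted ltn (y' :: t')).
  have -> := sorted_uniq ltn_trans ltnn (path_sorted ps); rewrite andbT andTb.
  apply/hasPn => _ /mapP[i si ->]; apply/mapP => -[j jt].
  have xi : (x' < i)%N by move: (order_path_min ltn_trans ps) => /allP; apply.
  have yj : (y' <= j)%N.
    move: jt; rewrite inE => /orP[/eqP->//|jt]; apply: ltnW.
    by move: (order_path_min ltn_trans pt) => /allP; apply.
  lia.
have p_iota k m : path ltn k (iota k.+1 m) by exact: (iota_ltn_sorted k m.+1).
have hook_mem (m : int) :
  (m \in hook a b (iota a.+1 (size s)) (iota b.+1 (size t))) =
  (a%:Z - b%:Z - (size t)%:Z <= m <= a%:Z - b%:Z + (size s)%:Z).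
  rewrite /hook mem_cat; apply/idP/idP.
    by case/orP => /mapP[j]; rewrite ?inE ?mem_iota => ? ->; lia.
  move=> mab; case: (lerP m (a%:Z - b%:Z)) => mle; apply/orP.
    left; apply/mapP; exists (`|a%:Z - m|%N); last lia.
    by rewrite -/(iota b (size t).+1) mem_iota; lia.
  by right; apply/mapP; exists (absz (m + b%:Z)); rewrite ?mem_iota; lia.
apply: (@sum_le_centered (uphalf (size s + size t))).
- exact: hook_uniq.
- exact: hook_uniq.
- by rewrite /hook !size_cat !size_map /= !size_iota.
- by move=> m; rewrite hook_mem; move: ab ba => /=; lia.
- by move=> m; rewrite hook_mem; move: ab ba => /=; lia.
Qed.

(** Layer-cake decomposition along a sorted list: the layer at level v has the
    height by which v exceeds the preceding value, so repeated values give
    layers of height 0. *)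
Lemma layers_path (c : R) (s : seq R) : path <=%R c s ->
  exists L : seq (R * R),
  [/\ all (fun l => 0 <= l.2) L, all (fun l => c <= l.1) L &
    {in c :: s, forall z, z - c = \sum_(l <- L) l.2 * (l.1 <= z)%R%:R}].
Proof.
elim: s c => [|x s IH] c /=.
  by move=> _; exists [::]; split=> // z; rewrite inE big_nil => /eqP ->; rewrite subrr.
case/andP => cx /IH[L [L0 Lx HL]]; exists ((x, x - c) :: L); split=> /=.
- by rewrite subr_ge0 cx.
- by rewrite cx; apply: sub_all Lx => l; exact: le_trans.
- move=> z; rewrite inE big_cons /= => /orP[/eqP ->|zs].
    rewrite subrr; case: (lerP x c) => [xc|xc].
      have {cx xc}-> : c = x by apply/le_anti/andP; split.
      by rewrite -(HL x) ?mem_head// subrr mul0r addr0.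
    rewrite mulr0 add0r big_seq big1// => l /(allP Lx) xl.
    by rewrite leNgt (lt_le_trans xc xl) mulr0.
  have xz : x <= z.
    rewrite -subr_ge0 HL// big_seq; apply: sumr_ge0 => l /(allP L0) l0.
    by rewrite mulr_ge0.
  by rewrite -HL// xz mulr1; ring.
Qed.

Lemma layers (s : seq R) : all (fun z => 0 <= z) s ->
  exists2 L : seq (R * R), all (fun l => 0 <= l.2) L &
    {in s, forall z, z = \sum_(l <- L) l.2 * (l.1 <= z)%R%:R}.
Proof.
move=> s0; have ps : path <=%R 0 (sort <=%R s).
  rewrite path_min_sorted ?sort_sorted//; first exact: le_total.
  by rewrite all_sort.
have [L [L0 _ HL]] := layers_path ps; exists L => // z zs.
by rewrite -HL ?subr0// inE mem_sort zs orbT.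
Qed.

(** Decomposing z into layers turns a quadratic form in z into a combination of
    sums over pairs of level sets, weighted by the heights of the layers. *)
Lemma quadratic_layers (L : seq (R * R)) (z : nat -> R) (s : seq nat) (G : nat -> nat -> R) :
  {in s, forall i, z i = \sum_(l <- L) l.2 * (l.1 <= z i)%R%:R} ->
  \sum_(i <- s) \sum_(j <- s) z i * z j * G i j =
  \sum_(l <- L) \sum_(l' <- L) l.2 * l'.2 *
    \sum_(i <- [seq i <- s | l.1 <= z i]) \sum_(j <- [seq j <- s | l'.1 <= z j]) G i j.
Proof.
move=> zE.
transitivity (\sum_(i <- s) \sum_(j <- s) \sum_(l <- L) \sum_(l' <- L)
   l.2 * l'.2 * ((l.1 <= z i)%R%:R * ((l'.1 <= z j)%R%:R * G i j))).
  rewrite big_seq [RHS]big_seq; apply: eq_bigr => i si.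
  rewrite big_seq [RHS]big_seq; apply: eq_bigr => j sj.
  rewrite {1}(zE _ si) {1}(zE _ sj) mulr_suml mulr_suml; apply: eq_bigr => l _.
  rewrite mulr_sumr mulr_suml; apply: eq_bigr => l' _; ring.
under eq_bigr do rewrite exchange_big.
rewrite exchange_big; apply: eq_bigr => l _ /=.
under eq_bigr do rewrite exchange_big.
rewrite exchange_big; apply: eq_bigr => l' _ /=.
rewrite big_filter [in RHS]big_mkcond mulr_sumr; apply: eq_bigr => i _ /=.
case: ifP => _; last by rewrite mulr0 big1// => j _; rewrite mul0r mulr0.
rewrite big_filter [in RHS]big_mkcond mulr_sumr; apply: eq_bigr => j _ /=.
by case: ifP => _; rewrite ?mul1r ?mul0r ?mulr0.
Qed.

End Rearrangement.

Section Arrangement.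
Variable R : realType.

(** The index in position i of the chain that defines [arranged]; both parities
    of n alternate between the two sides of n/2, and this formula covers both. *)
Definition place (n i : nat) : nat :=
  if odd (n + i) then ((n + i).+1)./2 else (n - i)./2.

Lemma arranged_place (n : nat) (y : nat -> R) (i j : nat) :
  arranged n y -> (i <= j <= n)%N -> y (place n j) <= y (place n i).
Proof.
move=> ary /andP[ij jn]; have step k : (k < n)%N -> y (place n k.+1) <= y (place n k).
  move=> kn; rewrite /place addnS [odd (n + k).+1]/=.
  move: ary; rewrite /arranged; case: ifPn => n_odd [h1 h2]; have [nk_odd|nk_odd] /= := boolP (~~ odd (n + k)); rewrite ?(negbTE nk_odd) ?(negbNE nk_odd).
  - move: (h2 k./2 ltac:(lia)).
    rewrite (_ : (uphalf n + (k./2).+1)%N = ((n + k).+2)./2); last lia.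
    by rewrite (_ : (n./2 - k./2)%N = (n - k)./2) //; lia.
  - move: (h1 k./2 ltac:(lia)).
    rewrite (_ : (uphalf n + (k./2))%N = ((n + k).+1)./2); last lia.
    by rewrite (_ : (n./2 - k./2)%N = (n - k.+1)./2)//; lia.
  - move: (h1 k./2 ltac:(lia)).
    rewrite (_ : (n./2 + (k./2).+1)%N = ((n + k).+2)./2); last lia.
    by rewrite (_ : (n./2 - k./2)%N = (n - k)./2)//; lia.
  - move: (h2 k./2 ltac:(lia)).
    rewrite (_ : (n./2 + (k./2).+1)%N = ((n + k).+1)./2); last lia.
    by rewrite (_ : (n./2 - (k./2).+1)%N = (n - k.+1)./2)//; lia.
elim: j ij jn => [|j IH]; first by rewrite leqn0 => /eqP ->.
rewrite leq_eqVlt => /orP[/eqP -> //|ij] jn.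
by apply: le_trans (step _ jn) _; apply: IH => //; exact: ltnW.
Qed.

(** A level set of an arranged sequence is an initial segment of the chain, hence
    an interval.  The bounds on 2a + p say that the centres of all these intervals
    lie within 1/2 of each other. *)
Lemma arranged_level (n : nat) (y : nat -> R) (v : R) : arranged n y ->
  exists a p, [/\ [seq i <- iota 0 n.+1 | v <= y i] = iota a p,
    (n < 2 * a + p)%N & (2 * a + p <= n.+2)%N].
Proof.
move=> ary; pose p := find (fun i => y (place n i) < v) (iota 0 n.+1).
have pn : (p <= n.+1)%N by rewrite -[n.+1 in leqRHS](size_iota 0) find_size.
exists ((n.+2 - p)./2), p; split; [|lia|lia].
have ltP i : (i <= n)%N -> (v <= y (place n i)) = (i < p)%N.
  move=> le_in; case: (ltnP i p) => ip.
    have := before_find 0%N ip; rewrite nth_iota ?add0n; last lia.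
    by move=> /negbT; rewrite -leNgt.
  have hp : has (fun i => y (place n i) < v) (iota 0 n.+1).
    by rewrite has_find size_iota -/p; lia.
  have := nth_find 0%N hp; rewrite -/p nth_iota ?add0n; last lia.
  move=> yp; apply/negbTE; rewrite -ltNge; apply: le_lt_trans yp.
  by apply: arranged_place => //; rewrite ip.
apply: (irr_sorted_eq ltn_trans ltnn).
- exact: sorted_filter ltn_trans _ _ (iota_ltn_sorted _ _).
- exact: iota_ltn_sorted.
move=> k; rewrite mem_filter !mem_iota add0n ltnS /=.
case: (leqP k n) => kn; last by rewrite andbF; lia.
(* r is the position of k in the chain, the inverse of place. *)
rewrite andbT; pose r := (if (n < 2 * k) then 2 * k - n.+1 else n - 2 * k)%N.
have -> : k = place n r by rewrite /place /r; case: ifP; case: ifP; lia.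
rewrite ltP; last by rewrite /r; case: ifP; lia.
by rewrite /place /r; case: ifP; case: ifP; lia.
Qed.

(** Level sets of x and y at the same height have the same size, because y is a
    permutation of x; those of y are nearly concentric intervals, so
    [riesz_interval] compares each pair of levels. *)
Lemma riesz_rearrangement (g : nat -> R) (n : nat) (x y : nat -> R) :
  (forall i j, (i <= j)%N -> g j <= g i) ->
  (forall i, 0 <= x i) -> perm_eq (mkseq y n.+1) (mkseq x n.+1) ->
  arranged n y ->
  \sum_(i <- iota 0 n.+1) \sum_(j <- iota 0 n.+1) x i * x j * g `|i%:Z - j%:Z|%N <=
  \sum_(i <- iota 0 n.+1) \sum_(j <- iota 0 n.+1) y i * y j * g `|i%:Z - j%:Z|%N.
Proof.
move=> g_dec x0 pyx ary.
have [|L L0 HL] := @layers R (mkseq x n.+1).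
  by apply/allP => _ /mapP[i _ ->].
rewrite (@quadratic_layers R L x); last first.
  by move=> i si; apply: HL; exact: map_f.
rewrite (@quadratic_layers R L y); last first.
  by move=> i si; apply: HL; rewrite -(perm_mem pyx); exact: map_f.
rewrite big_seq [leRHS]big_seq; apply: ler_sum => l /(allP L0) l0.
rewrite big_seq [leRHS]big_seq; apply: ler_sum => l' /(allP L0) l'0.
rewrite ler_wpM2l ?mulr_ge0//.
have sz v : size [seq i <- iota 0 n.+1 | v <= x i] = size [seq i <- iota 0 n.+1 | v <= y i].
  rewrite !size_filter.
  rewrite -(count_map x (fun z => v <= z)) -(count_map y (fun z => v <= z)).
  by symmetry; move/permP: pyx; apply.
have [a [p [ap p1 p2]]] := arranged_level l.1 ary.
have [b [q [bq q1 q2]]] := arranged_level l'.1 ary.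
have := @riesz_interval R g g_dec [seq i <- iota 0 n.+1 | l.1 <= x i] [seq i <- iota 0 n.+1 | l'.1 <= x i] a b.
rewrite !sz ap bq !size_iota; apply; try lia.
- exact: sorted_filter ltn_trans _ _ (iota_ltn_sorted _ _).
- exact: sorted_filter ltn_trans _ _ (iota_ltn_sorted _ _).
Qed.
End Arrangement.

(** * Lebesgue integrals, translations and periods *)

Section Lebesgue.
Variable R : realType.
Notation leb := (@lebesgue_measure R).
Notation cleb := (@completed_lebesgue_measure R).
Implicit Types D : set R.

Lemma borel_lebesgue D :
  measurable D -> measurable (D : set (lebesgueType R)).
Proof. exact: sub_caratheodory. Qed.

Lemma measurable_idL : measurable_fun setT (id : lebesgueType R -> R).
Proof. by move=> _ B mB; rewrite setTI; exact: borel_lebesgue. Qed.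

Lemma measurable_borel_lebesgue (f : R -> R) :
  measurable_fun setT f ->
  measurable_fun setT (f : lebesgueType R -> R).
Proof. by move=> mf; exact: (measurableT_comp mf measurable_idL). Qed.

(** The identity, from the Lebesgue to the Borel sigma-algebra, pushes the
    completed measure forward to Lebesgue measure. *)
Lemma completed_integral D (f : R -> \bar R) :
  measurable D ->
  measurable_fun D f -> (forall x, D x -> (0 <= f x)%E) ->
  (\int[cleb]_(x in D) f x = \int[leb]_(x in D) f x)%E.
Proof.
move=> mD mf f0; symmetry.
have := @ge0_integral_pushforward _ _ (lebesgueType R) (measurableTypeR R) R id measurable_idL cleb D f mD mf.
by apply=> x /set_mem; exact: f0.
Qed.

Lemma measurable_shift (c : R) :
  measurable_fun setT (fun x : R => x + c).
Proof. exact: measurable_funD. Qed.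

Lemma lebesgue_shift (c : R) (A : set (measurableTypeR R)) : measurable A ->
  pushforward leb ((fun x : R => x + c) : _ -> measurableTypeR R) A = leb A.
Proof.
move=> mA; apply/esym/lebesgue_measure_unique => //=; first exact: measurable_shift.
move=> mc _ [[a b]] _ <-.
rewrite /pushforward (_ : _ @^-1` _ = `]a - c, b - c]%classic); last first.
  by apply/seteqP; split => x /=; rewrite !in_itv/= ltrBlDr lerBrDr.
by rewrite !lebesgue_measure_itv/= !lte_fin ltrD2r; case: ifP => // _; rewrite -?EFinB; congr EFin; ring.
Qed.

Lemma integral_shift (c : R) D (f : R -> \bar R) : measurable D ->
  measurable_fun D f -> (forall x, (0 <= f x)%E) ->
  (\int[leb]_(x in (fun x : R => x + c)%R @^-1` D) f (x + c)%R = \int[leb]_(x in D) f x)%E.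
Proof.
move=> mD mf f0.
have <- := @ge0_integral_pushforward _ _ (measurableTypeR R) (measurableTypeR R) R (fun x => x + c) (measurable_shift c) leb D f mD mf.
  apply: eq_measure_integral; first exact: measurable_shift.
  by move=> mc A mA _; exact: (@lebesgue_shift c A mA).
by move=> x _.
Qed.

Lemma integral_shift_itv (c a b : R) (f : R -> \bar R) :
  measurable_fun setT f -> (forall x, (0 <= f x)%E) ->
  (\int[leb]_(x in `]a, b]) f (x + c)%R = \int[leb]_(x in `](a + c)%R, (b + c)%R]) f x)%E.
Proof.
move=> mf f0; rewrite -[RHS](@integral_shift c)//; last exact: measurable_funTS.
by congr integral; apply/seteqP; split => x /=; rewrite !in_itv/= ltrD2r lerD2r.
Qed.

Lemma integral_itv_cat (a b c : R) (f : R -> \bar R) :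
  measurable_fun setT f -> (forall x, (0 <= f x)%E) -> a <= b -> b <= c ->
  (\int[leb]_(x in `]a, c]) f x =
   \int[leb]_(x in `]a, b]) f x + \int[leb]_(x in `]b, c]) f x)%E.
Proof.
move=> mf f0 ab bc; rewrite -ge0_integral_setU//=.
- congr integral; apply/seteqP; split => x /=; rewrite !in_itv/=.
    by move=> /andP[ax xc]; case: (leP x b) => xb; [left|right]; rewrite ?ax ?xc.
  by case=> /andP[h1 h2]; apply/andP; split; lra.
- exact: measurable_funTS.
- apply/disj_setPS => x [] /=; rewrite !in_itv /= => /andP[_ xb] /andP[bx _]; lra.
Qed.

(** With a - b = k L + r and 0 <= r < L, a translation by k L reduces to the window
    ]b + r, b + r + L], whose part beyond b + L is a translate of ]b, b + r]. *)
Lemma integral_period (L a b : R) (f : R -> \bar R) :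
  measurable_fun setT f -> (forall x, (0 <= f x)%E) -> 0 < L ->
  (forall x, f (x + L) = f x) ->
  (\int[leb]_(x in `]a, (a + L)%R]) f x = \int[leb]_(x in `]b, (b + L)%R]) f x)%E.
Proof.
wlog ba : a b / b <= a => [wlg mf f0 L0 fL|mf f0 L0 fL].
  by have [ab|ba] := leP a b; [symmetry|]; apply: wlg => //; exact: ltW.
have fLn n x : f (x + L *+ n) = f x.
  elim: n => [|n IH]; first by rewrite mulr0n addr0.
  by rewrite mulrSr addrA fL.
pose k := Num.truncn ((a - b) / L).
have /truncn_itv/andP[k1 k2] : 0 <= (a - b) / L by rewrite divr_ge0// ?subr_ge0// ltW.
pose r := a - b - L *+ k.
have r0 : 0 <= r by rewrite subr_ge0 -mulr_natr mulrC -ler_pdivlMr.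
have rL : r < L by rewrite ltrBlDr -mulrS -mulr_natr mulrC -ltr_pdivrMr.
transitivity (\int[leb]_(x in `](b + r)%R, (b + r + L)%R]) f x)%E.
  have -> : a = b + r + L *+ k by rewrite /r; ring.
  rewrite (addrAC (b + r)) -integral_shift_itv//.
  by apply: eq_integral => x _; rewrite fLn.
rewrite (@integral_itv_cat _ (b + L))//; [|lra|lra].
rewrite [RHS](@integral_itv_cat _ (b + r))//; [|lra|lra].
rewrite [RHS]addeC; congr (_ + _)%E.
rewrite -integral_shift_itv//.
by apply: eq_integral => x _; rewrite fL.
Qed.
End Lebesgue.

(** * Trigonometry and the angle parametrization *)

Section Trig.
Variable R : realType.
Implicit Types (x y t : R).

Lemma cos_abs x : cos `|x| = cos x.
Proof. by case: (ger0P x) => // _; rewrite cosN. Qed.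

(** Within half a period of a crest, the cosine measures the distance to it. *)
Lemma ler_cos_abs x y : `|x| <= pi -> `|y| <= pi -> (cos y <= cos x) = (`|x| <= `|y|).
Proof.
move=> xpi ypi; rewrite -(cos_abs x) -(cos_abs y) leNgt ltr_cos -?leNgt//;
  by rewrite in_itv/= normr_ge0.
Qed.

Lemma cos_nat_period (m : nat) x : cos (m%:R * (x + 2 * pi)) = cos (m%:R * x).
Proof.
rewrite mulrDr (_ : m%:R * (2 * pi) = pi *+ 2 *+ m).
  by rewrite (periodicn (@cosD2pi R)).
by rewrite !mulr_natl.
Qed.

Lemma sin_nat_period (m : nat) x : sin (m%:R * (x + 2 * pi)) = sin (m%:R * x).
Proof.
rewrite mulrDr (_ : m%:R * (2 * pi) = pi *+ 2 *+ m).
  by rewrite (periodicn (@sinD2pi R)).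
by rewrite !mulr_natl.
Qed.

Lemma phase (c s : R) : c ^+ 2 + s ^+ 2 = 1 -> exists p, c = cos p /\ s = sin p.
Proof.
move=> cs1; have c1 : -1 <= c <= 1.
  rewrite -ler_norml -(@ler_pXn2r _ 2)// ?nnegrE// expr1n real_normK ?num_real//.
  by rewrite -cs1 lerDl sqr_ge0.
have sE : Num.sqrt (1 - c ^+ 2) = `|s| by rewrite -sqrtr_sqr -cs1; congr Num.sqrt; ring.
have cosE : cos (acos c) = c by rewrite acosK.
have := sin_acos c1; rewrite sE; case: (ger0P s) => _ sinE.
  by exists (acos c).
by exists (- acos c); rewrite cosN sinN sinE opprK.
Qed.

Lemma expi_exp t (j : nat) :
  (cos t +i* sin t) ^+ j = cos (j%:R * t) +i* sin (j%:R * t) :> R[i].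
Proof.
elim: j => [|j IH]; first by rewrite expr0 mul0r cos0 sin0.
rewrite exprS IH -natr1 mulrDl mul1r addrC cosD sinD.
by apply/eqP; rewrite eq_complex /=; apply/andP; split; apply/eqP; ring.
Qed.
End Trig.

Section Circle.
Variable R : realType.
Notation cleb := (@completed_lebesgue_measure R).
Notation leb := (@lebesgue_measure R).

Definition angles (A : set (circle R)) : set (lebesgueType R) :=
  @angle_range R `&` expi @^-1` A.

Lemma measurable_angles (A : set (circle R)) : measurable A -> measurable (angles A).
Proof. by []. Qed.

Lemma measurable_circle_fun (F : circle R -> R) :
  measurable_fun setT (fun t : R => F (expi t)) -> measurable_fun setT F.
Proof.
move=> mF _ B mB; rewrite setTI.
have := measurable_borel_lebesgue mF measurableT mB; rewrite setTI => mFB.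
by apply: measurableI => //; exact: measurable_angle_range.
Qed.

(** Arc length is the image of the measure restricted to ]-pi, pi], under the map
    phi that is the exponential on this window and constant off it.  Measurability
    of phi on the whole line is immediate, since the sigma-algebra of the circle
    is defined through this window. *)
Lemma arc_length_integral (A : set (circle R)) (F : circle R -> \bar R) :
  measurable A -> measurable_fun setT F -> (forall z, (0 <= F z)%E) ->
  (\int[@arc_length R]_(z in A) F z = \int[cleb]_(t in angles A) F (expi t))%E.
Proof.
move=> mA mF F0; pose D := @angle_range R.
have mD : measurable D := @measurable_angle_range R.
pose phi : lebesgueType R -> circle R := patch (fun=> expi 0) D expi.
have phiE t : D t -> phi t = expi t by move=> Dt; rewrite /phi patchE mem_set.
have phiB B : phi @^-1` B `&` D = D `&` expi @^-1` B.
  by apply/seteqP; split => [t [Bt Dt]|t [Dt Bt]]; split => //; move: Bt; rewrite /= phiE.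
have mphi : measurable_fun setT phi.
  move=> _ B mB; rewrite setTI -[X in measurable X](setUIDK _ D) phiB.
  apply: measurableU; first exact: mB.
  have [B0|B0] := pselect (B (expi 0)).
    rewrite (_ : _ `\` _ = ~` D); first exact: measurableC.
    apply/seteqP; split => [t []//|t Dt]; split=> //.
    by rewrite /= /phi patchE memNset.
  rewrite (_ : _ `\` _ = set0)//; apply/seteqP; split => // t [+ Dt].
  by rewrite /= /phi patchE memNset.
pose mu := mrestr cleb mD.
transitivity (\int[mu]_(t in phi @^-1` A) F (phi t))%E.
  rewrite -[RHS](@ge0_integral_pushforward _ _ _ _ R phi mphi mu)//; last first.
    exact: measurable_funTS.
  apply: eq_measure_integral => B mB _.
  by rewrite -[RHS]/(cleb (phi @^-1` B `&` D)) phiB.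
have mphiA : measurable (phi @^-1` A).
  by rewrite -[X in measurable X]setTI; exact: mphi.
have mDc : measurable (~` D) by exact: measurableC.
have mFphi : measurable_fun (phi @^-1` A) (F \o phi).
  by apply: measurable_funTS; exact: measurableT_comp.
have muDc : mu (~` D) = 0%E.
  by rewrite -[LHS]/(cleb (~` D `&` D)) setICl measure0.
rewrite (@ge0_negligible_integral _ _ _ mu _ _ _ mDc mphiA mFphi _ muDc); last first.
  by move=> t _; exact: F0.
rewrite setDE setCK phiB.
transitivity (\int[cleb]_(t in angles A) F (phi t))%E.
  apply: eq_measure_integral => B mB BA.
  by rewrite -[LHS]/(cleb (B `&` D)) setIidl// => t /BA[].
by apply: eq_integral => t /set_mem[Dt _]; rewrite phiE.
Qed.

End Circle.

Section Arcs.
Variable R : realType.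
Notation cleb := (@completed_lebesgue_measure R).
Notation leb := (@lebesgue_measure R).

Lemma expi_inj (s t : R) : expi s = expi t -> cos s = cos t /\ sin s = sin t.
Proof. by move/(congr1 val) => [-> ->]. Qed.

(** The half-length D/2 is at most pi, so the points of the arc are those where the
    cosine centered at its midpoint is at least cos (D/2).  Describing the arc by
    this inequality avoids any choice of angles modulo 2 pi. *)
Lemma cos_arc (a D t : R) : 0 <= D <= 2 * pi -> Defs.arc a D (expi t) ->
  cos (D / 2) <= cos (t - (a + D / 2)).
Proof.
move=> /andP[D0 D2]; rewrite /Defs.arc /= => -[s]; rewrite in_itv/= => /andP[s1 s2] /esym/expi_inj[ct st].
rewrite cosB ct st -cosB.
have sc : `|s - (a + D / 2)| <= D / 2 by rewrite ler_norml; apply/andP; split; lra.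
have Dn : `|D / 2| = D / 2 by rewrite ger0_norm//; lra.
rewrite ler_cos_abs ?Dn//; last lra.
by rewrite (le_trans sc)//; lra.
Qed.

Lemma angles_centered_arc (T : R) : 0 <= T <= 2 * pi ->
  angles (centered_arc T) = @angle_range R `&` `[- (T / 2), T / 2].
Proof.
move=> /andP[T0 T2]; apply/seteqP; split => t [Dt]; rewrite /= /centered_arc /=.
  move=> [s]; rewrite in_itv/= => /andP[s1 s2] /esym/expi_inj[ct _]; split => //.
  have : `|t| = `|s|.
    have tpi : `|t| <= pi.
      by move: Dt; rewrite /angle_range/= in_itv/= ler_norml => /andP[t1 ->]; rewrite ltW.
    have spi : `|s| <= pi by rewrite ler_norml; apply/andP; split; lra.
    by apply/le_anti; rewrite -!ler_cos_abs// ct lexx.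
  move=> ts; rewrite in_itv/= -ler_norml ts ler_norml; apply/andP; split; lra.
by move=> tT; split => //; exists t.
Qed.

Lemma measurable_centered_arc (T : R) : 0 <= T <= 2 * pi -> measurable (centered_arc T).
Proof.
move=> T2; rewrite -[measurable _]/(measurable (angles (centered_arc T))).
rewrite angles_centered_arc//; apply: measurableI; first exact: measurable_angle_range.
exact: borel_lebesgue.
Qed.

Lemma measurable_cosZ (k b : R) : measurable_fun setT (fun x : R => cos (k * x + b)).
Proof.
apply: continuous_measurable_fun => x; apply: continuous_comp; last exact: continuous_cos.
by apply: cvgD; [apply: cvgM; [exact: cvg_cst|exact: cvg_id]|exact: cvg_cst].
Qed.

(** A set essentially contained in an arc is covered, up to a null set, by the
    superlevel set K of [cos_arc].  K is 2 pi-periodic, so the window ]-pi, pi] may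
    be moved to the one centered at the midpoint of the arc, where K is the
    interval [a, a + D]. *)
Lemma integral_le_arc (A : set (circle R)) (a D : R) (f : R -> R) :
  measurable A -> (@arc_length R).-negligible (A `\` Defs.arc a D) ->
  0 <= D <= 2 * pi -> measurable_fun setT f -> (forall x, 0 <= f x) ->
  (forall x, f (x + 2 * pi) = f x) ->
  (\int[cleb]_(t in angles A) (f t)%:E <= \int[leb]_(t in `[a, (a + D)%R]) (f t)%:E)%E.
Proof.
move=> mA [N [mN N0 AN]] D2 mf f0 fper.
pose K := [set t : R | cos (D / 2) <= cos (t - (a + D / 2))].
have mK : measurable K.
  have -> : K = (fun t => cos (1 * t - (a + D / 2))) @^-1` `[cos (D / 2), +oo[.
    by apply/seteqP; split => t; rewrite /K /= in_itv/= andbT mul1r.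
  by rewrite -[X in measurable X]setTI; exact: measurable_cosZ.
have mKL : measurable (K : set (lebesgueType R)) by exact: borel_lebesgue.
have mEf : measurable_fun setT (EFin \o f) by exact/measurable_EFinP.
have mEfL (B : set (lebesgueType R)) :
    measurable_fun B (EFin \o f : lebesgueType R -> \bar R).
  exact/measurable_EFinP/measurable_funTS/measurable_borel_lebesgue.
have mR := @measurable_angle_range R.
have mRK : measurable (@angle_range R `&` K) by exact: measurableI.
have mAN : measurable (angles N) by exact: measurable_angles.
have mU : measurable (angles N `|` @angle_range R `&` K) by exact: measurableU.
have mUN : measurable ((angles N `|` @angle_range R `&` K) `\` angles N).
  exact: measurableD.
have Ef0 (x : R) : (0 <= (f x)%:E)%E by rewrite lee_fin.
apply: (@le_trans _ _ (\int[cleb]_(t in angles N `|` @angle_range R `&` K) (f t)%:E)%E).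
  apply: (@ge0_subset_integral _ _ _ cleb _ _ (measurable_angles mA) mU _ (mEfL _)).
    by move=> t _; exact: Ef0.
  move=> t [Dt At]; have [Nt|Nt] := pselect (N (expi t)); first by left.
  right; split=> //; apply: (cos_arc D2); apply: contrapT => nt.
  by apply: Nt; exact: AN.
rewrite (@ge0_negligible_integral _ _ _ cleb _ _ _ mAN mU (mEfL _) _ N0); last first.
  by move=> t _; exact: Ef0.
apply: (@le_trans _ _ (\int[cleb]_(t in @angle_range R `&` K) (f t)%:E)%E).
  apply: (@ge0_subset_integral _ _ _ cleb _ _ mUN mRK _ (mEfL _)).
    by move=> t _; exact: Ef0.
  by move=> t [[]].
have mBRK : measurable (`]- pi, pi]%classic `&` K) by exact: measurableI.
rewrite (@completed_integral _ _ _ mBRK (measurable_funTS mEf)); last first.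
  by move=> t _; exact: Ef0.
rewrite integral_mkcondr.
pose c := a + D / 2.
have -> : (\int[leb]_(x in @angle_range R) ((fun t => (f t)%:E) \_ K) x =
    \int[leb]_(x in `](c - pi)%R, (c - pi + 2 * pi)%R]) ((fun t => (f t)%:E) \_ K) x)%E.
  rewrite (@integral_period _ _ _ (- pi)).
  - by congr integral; rewrite /angle_range (_ : - pi + 2 * pi = pi)//; ring.
  - apply/(measurable_restrictT _ mK); exact: measurable_funTS.
  - by move=> x; rewrite patchE; case: ifP.
  - by rewrite mulr_gt0// pi_gt0.
  - move=> x; rewrite !patchE fper.
    suff -> : (x + 2 * pi \in K) = (x \in K) by [].
    apply/idP/idP => /set_mem h; apply/mem_set; move: h; rewrite /K /=;
    by rewrite addrAC -(mul1r (x - _ + _)) (cos_nat_period 1) mul1r.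
rewrite -integral_mkcondr; apply: ge0_subset_integral.
- exact: measurableI.
- exact: measurable_itv.
- exact: measurable_funTS mEf.
- by move=> x _; exact: Ef0.
move=> x []; rewrite /K /= !in_itv/= => /andP[x1 x2].
have Dn : `|D / 2| = D / 2 by rewrite ger0_norm//; lra.
rewrite ler_cos_abs ?Dn//; last 2 first.
- by rewrite -/c ler_norml; apply/andP; split; lra.
- lra.
by rewrite ler_norml => /andP[x3 x4]; apply/andP; split; lra.
Qed.
End Arcs.

(** * The bathtub principle on an arc *)

Section Bathtub.
Variable R : realType.
Notation cleb := (@completed_lebesgue_measure R).
Notation leb := (@lebesgue_measure R).

Lemma integrable_angles (A : set (circle R)) (f : R -> R) (M : R) :
  measurable A -> measurable_fun setT f -> (forall x, `|f x| <= M) ->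
  cleb.-integrable (angles A) (EFin \o f).
Proof.
move=> mA mf fM; apply: measurable_bounded_integrable => //.
- have : (arc_length A <= arc_length [set: circle R])%E by rewrite le_measure ?inE.
  by rewrite arc_lengthT => /le_lt_trans; apply; exact: ltry.
- apply: measurable_funTS; exact: measurable_borel_lebesgue.
- by exists M; split; [exact: num_real|move=> B /ltW MB x _; exact: le_trans MB].
Qed.

Lemma integrable_itv (a b : R) (f : R -> R) (M : R) :
  measurable_fun setT f -> (forall x, `|f x| <= M) ->
  leb.-integrable `]a, b] (EFin \o f).
Proof.
move=> mf fM; apply: measurable_bounded_integrable => //.
- by rewrite /= lebesgue_measure_itv; case: ifP => _; exact: ltry.
- exact: measurable_funTS.
- by exists M; split; [exact: num_real|move=> B /ltW MB x _; exact: le_trans MB].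
Qed.

Lemma cos_le_norm1 (x : R) : `|cos x| <= 1.
Proof. by rewrite ler_norml cos_geN1 cos_le1. Qed.

(** The essential arc diameter is an infimum; approximation by slightly longer
    arcs is all that its definition gives at once, and it is enough below. *)
Definition almost_in_arc (A : set (circle R)) (D : R) :=
  forall e : R, 0 < e -> exists a L, [/\ 0 <= L <= 2 * pi, L < D + e &
    (@arc_length R).-negligible (A `\` Defs.arc a L)].

Lemma ess_arc_diamP (A : set (circle R)) : almost_in_arc A (ess_arc_diam A).
Proof.
move=> e e0; rewrite /ess_arc_diam.
set S := [set D : R | _].
have hS : has_inf S.
  split; last by exists 0 => D [/andP[]].
  exists (2 * pi); split; first by rewrite lexx mulr_ge0// pi_ge0.
  (* The set of admissible D is nonempty: the arc from -pi of length 2 pi is the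
     whole circle, which shows in the angles of its complement. *)
  pose N := ~` Defs.arc (- pi : R) (2 * pi).
  have angN : angles N = set0.
    apply/seteqP; split => // x [Dx]; apply => /=; exists x => //.
    by move: Dx; rewrite /angle_range/= !in_itv/= => /andP[x1 x2]; apply/andP; split; lra.
  exists (- pi); exists N; split; last by move=> z [].
  - by rewrite -[measurable N]/(measurable (angles N)) angN.
  - by rewrite -[LHS]/(cleb (angles N)) angN measure0.
have [L [L2 [a aL]] Le] := inf_adherent e0 hS.
by exists a, L.
Qed.

(** [integral_le_arc] for the constant function 1. *)
Lemma arc_length_le_diam (A : set (circle R)) (T D : R) :
  measurable A -> arc_length A = T%:E -> almost_in_arc A D -> T <= D.
Proof.
move=> mA AT AD; apply/ler_addgt0Pr => e /AD[a [L [L2 LD neg]]].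
apply: le_trans (ltW LD); rewrite -lee_fin -AT.
have m1 : measurable_fun setT (fun _ : R => 1 : R) by exact: measurable_cst.
have := @integral_le_arc _ _ _ _ (fun=> 1) mA neg L2 m1 (fun=> ler01) (fun=> erefl).
rewrite !integral_cst//= !mul1e lebesgue_measure_itv/= lte_fin.
case: ifP => _ /le_trans; apply; rewrite -?EFinD lee_fin; [|by case/andP: L2].
by rewrite addrAC subrr add0r.
Qed.

(** With w the wave and t its value at distance T/2 from a crest, the integral of
    w - t over A is at most that of f = max(w - t, 0).  By [integral_le_arc] and
    periodicity, the latter is at most the integral of f over one period, up to an
    error that vanishes with the excess e of the arc over D.  Over the period
    centered at a crest, f is w - t on the interval of length T and 0 elsewhere.
    Since A and this interval both have measure T, the terms in t cancel. *)
Lemma bathtub (A : set (circle R)) (T D p : R) (m : nat) :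
  measurable A -> 0 < T -> arc_length A = T%:E -> almost_in_arc A D ->
  (0 < m)%N -> m%:R * D <= 2 * pi ->
  \int[cleb]_(x in angles A) cos (m%:R * x - p) <=
  \int[leb]_(x in `]- (T / 2), T / 2]) cos (m%:R * x).
Proof.
move=> mA T0 AT AD m0 mD.
have TD := arc_length_le_diam mA AT AD.
have mR0 : 0 < m%:R :> R by rewrite ltr0n.
pose P : R := 2 * pi / m%:R.
have PE : m%:R * P = 2 * pi by rewrite /P mulrC divfK// gt_eqF.
have P0 : 0 < P by rewrite divr_gt0// mulr_gt0// pi_gt0.
have DP : D <= P by rewrite /P ler_pdivlMr// mulrC.
pose t := cos (m%:R * (T / 2)).
pose f (x : R) : R := Num.max (cos (m%:R * x - p) - t) 0.
have mcos (k b : R) : measurable_fun setT (fun x : R => cos (k * x + b)) by exact: measurable_cosZ.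
have mf : measurable_fun setT f.
  by apply: measurable_maxr => //; exact: measurable_funB.
have f0 x : 0 <= f x by rewrite /f le_max lexx orbT.
have f2 x : f x <= 2.
  rewrite /f ge_max ler0n andbT.
  by have := cos_le1 (m%:R * x - p); have := cos_geN1 (m%:R * (T/2)); rewrite -/t; lra.
have fP x : f (x + P) = f x.
  by rewrite /f mulrDr PE addrAC -(mul1r (_ + 2 * pi)) (cos_nat_period 1) mul1r.
have fpi x : f (x + 2 * pi) = f x.
  by rewrite -PE mulr_natl; elim: (m) => [|k IH]; rewrite ?mulr0n ?addr0// mulrSr addrA fP.
have mEf : measurable_fun setT (EFin \o f) by exact/measurable_EFinP.
have Ef0 x : (0 <= (f x)%:E)%E by rewrite lee_fin.
pose g := \int[leb]_(x in `]- (T / 2), T / 2]) cos (m%:R * x).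
(* The integral of f over the period centered at the crest p / m. *)
have base : (\int[leb]_(x in `](- (P / 2))%R, (P / 2)%R]) (f (x + p / m%:R)%R)%:E)%E =
    (g - T * t)%:E.
  have ic : leb.-integrable `]- (T / 2), T / 2] (EFin \o (fun x => cos (m%:R * x))).
    apply: (@integrable_itv _ _ _ 1) => [|x]; last exact: cos_le_norm1.
    by rewrite (_ : (fun _ => _) = fun x : R => cos (m%:R * x + 0))//; apply/funext => x; rewrite addr0.
  have it : leb.-integrable `]- (T / 2), T / 2] (EFin \o (fun=> t)).
    by apply: (@integrable_itv _ _ _ 1) => // x; exact: cos_le_norm1.
  have -> : g - T * t = \int[leb]_(x in `]- (T / 2), T / 2]) (cos (m%:R * x) - t).
    rewrite RintegralB// Rintegral_cst// /= lebesgue_measure_itv/= lte_fin ifT; last lra.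
    by rewrite -/g /=; congr (_ - _); field.
  rewrite /Rintegral fineK; last first.
    apply: integrable_fin_num => //.
    exact: (@integrableB _ _ _ leb _ _ (EFin \o (fun x => cos (m%:R * x))) (EFin \o (fun=> t))).
  have -> : (`]- (T / 2), T / 2]%classic : set R) = `]- (P / 2), P / 2]%classic `&` `]- (T / 2), T / 2]%classic.
    apply/seteqP; split => x /=; last by case.
    by rewrite !in_itv/= => /andP[x1 x2]; split; apply/andP; split; lra.
  rewrite integral_mkcondr; apply: eq_integral => x /set_mem; rewrite /= in_itv/= => /andP[x1 x2].
  rewrite patchE /f (_ : m%:R * (x + p / m%:R) - p = m%:R * x); last by field; rewrite gt_eqF.
  have mx : `|m%:R * x| <= pi.
    rewrite normrM normr_nat (le_trans (_ : _ <= m%:R * (P / 2)))//; last lra.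
    by rewrite ler_wpM2l// ler_norml; apply/andP; split; lra.
  have mT : `|m%:R * (T / 2)| = m%:R * (T / 2) by rewrite ger0_norm// mulr_ge0//; lra.
  have mTpi : `|m%:R * (T / 2)| <= pi.
    by rewrite mT (le_trans (_ : _ <= m%:R * (P / 2)))//; [rewrite ler_wpM2l//|]; lra.
  case: ifPn => [/set_mem|/negP xT].
    rewrite /= in_itv/= => /andP[x3 x4]; rewrite max_l// subr_ge0 /t ler_cos_abs// mT.
    rewrite normrM normr_nat ler_wpM2l// ler_norml; apply/andP; split; lra.
  rewrite max_r// subr_le0 /t ler_cos_abs// mT normrM normr_nat ler_wpM2l//.
  rewrite leNgt; apply/negP => xT2; apply: xT; apply/mem_set => /=; rewrite in_itv/=.
  by move: xT2; rewrite ltr_norml => /andP[x3 x4]; apply/andP; split; lra.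
have bound (e : R) : 0 < e -> \int[cleb]_(x in angles A) (cos (m%:R * x - p) - t) <= g - T * t + 4 * e.
  move=> e0; have [a [L [L2 LD neg]]] := AD e e0.
  have fA : (\int[cleb]_(x in angles A) (f x)%:E <= (g - T * t + 4 * e)%:E)%E.
    apply: le_trans (integral_le_arc mA neg L2 mf f0 fpi) _.
    (* One period starting at a - e, which absorbs the closed end point a,
       followed by an interval of length 2 e, where f <= 2. *)
    apply: (@le_trans _ _ (\int[leb]_(x in `](a - e)%R, (a - e + P + 2 * e)%R]) (f x)%:E)%E).
      apply: ge0_subset_integral => //; first exact: measurable_funTS.
      by move=> x /=; rewrite !in_itv/= => /andP[x1 x2]; apply/andP; split; lra.
    rewrite (@integral_itv_cat _ _ (a - e + P))//; [|lra|lra].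
    rewrite (@integral_period _ _ _ (p / m%:R - P / 2))//; last by move=> x; rewrite fP.
    rewrite EFinD; apply: leeD.
      rewrite (_ : p / m%:R - P / 2 = - (P / 2) + p / m%:R); last ring.
      rewrite (_ : - (P / 2) + p / m%:R + P = P / 2 + p / m%:R); last by field; rewrite gt_eqF.
      by rewrite -integral_shift_itv// base.
    apply: (@le_trans _ _ (\int[leb]_(x in `](a - e + P)%R, (a - e + P + 2 * e)%R]) 2%:E)%E).
      apply: ge0_le_integral => //.
      + exact: measurable_funTS.
      + by move=> x _; rewrite lee_fin.
    rewrite integral_cst//= lebesgue_measure_itv/=; case: ifP => _.
      by rewrite -EFinD -EFinM lee_fin; lra.
    by rewrite mule0 lee_fin; lra.
  have fle1 (x : R) : `|f x| <= 2 by rewrite ger0_norm.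
  have ifA := integrable_angles mA mf fle1.
  apply: (@le_trans _ _ (\int[cleb]_(x in angles A) f x)).
    apply: le_Rintegral => //; last by move=> x _; rewrite /f le_max lexx.
    apply: (@integrable_angles _ _ 2) => //; first exact: measurable_funB.
    move=> x; rewrite (le_trans (ler_normB _ _))//.
    by rewrite (_ : 2 = 1 + 1 :> R)// lerD// cos_le_norm1.
  rewrite -lee_fin /Rintegral fineK//; exact: integrable_fin_num.
have icos : cleb.-integrable (angles A) (EFin \o (fun x => cos (m%:R * x - p))).
  by apply: (@integrable_angles _ _ 1) => // x; exact: cos_le_norm1.
have icst : cleb.-integrable (angles A) (EFin \o (fun=> t)).
  by apply: (@integrable_angles _ _ 1) => // x; exact: cos_le_norm1.
apply/ler_addgt0Pr => e e0.
have := bound (e / 4) ltac:(lra).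
rewrite RintegralB// Rintegral_cst//.
rewrite (_ : fine _ = T); last by rewrite -[X in fine X]/(arc_length A) AT.
rewrite -/g lerBlDr => /le_trans; apply.
by rewrite le_eqVlt; apply/orP; left; apply/eqP; field.
Qed.
End Bathtub.

(** * The energy as a quadratic form in the coefficients *)

Section RintegralSum.
Context d (T : measurableType d) (R : realType) (mu : {measure set T -> \bar R}).

Lemma Rintegral_sum_seq (I : eqType) (s : seq I) (f : I -> T -> R) (D : set T) :
  measurable D -> {in s, forall i, mu.-integrable D (EFin \o f i)} ->
  mu.-integrable D (EFin \o (fun x => \sum_(i <- s) f i x)) /\
  \int[mu]_(x in D) (\sum_(i <- s) f i x) = \sum_(i <- s) \int[mu]_(x in D) f i x.
Proof.
move=> mD; elim: s => [|i s IH] intf.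
  rewrite big_nil (_ : (fun x => _) = fun=> 0); last by apply/funext => x; rewrite big_nil.
  split; first exact: (@integrable0 _ _ _ mu D).
  by rewrite Rintegral_cst// mul0r.
have [|ints sumE] := IH; first by move=> j js; apply: intf; rewrite inE js orbT.
have inti : mu.-integrable D (EFin \o f i) by apply: intf; rewrite mem_head.
rewrite big_cons (_ : (fun x => _) = fun x => f i x + \sum_(i <- s) f i x); last first.
  by apply/funext => x; rewrite big_cons.
split; last by rewrite RintegralD// sumE.
exact: (@integrableD _ _ _ mu D mD (EFin \o f i) (EFin \o (fun x => \sum_(i <- s) f i x))).
Qed.

Lemma Rintegral_sum2 (s : seq nat) (f : nat -> nat -> T -> R) (D : set T) :
  measurable D -> (forall i j, mu.-integrable D (EFin \o f i j)) ->
  mu.-integrable D (EFin \o (fun x => \sum_(i <- s) \sum_(j <- s) f i j x)) /\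
  \int[mu]_(x in D) (\sum_(i <- s) \sum_(j <- s) f i j x) =
  \sum_(i <- s) \sum_(j <- s) \int[mu]_(x in D) f i j x.
Proof.
move=> mD intf.
have inner i := @Rintegral_sum_seq _ s (f i) D mD (fun j _ => intf i j).
have [? ->] := @Rintegral_sum_seq _ s (fun i x => \sum_(j <- s) f i j x) D mD (fun i _ => (inner i).1).
by split => //; apply: eq_bigr => i _; rewrite (inner i).2.
Qed.
End RintegralSum.

Section Energy.
Variable R : realType.
Notation cleb := (@completed_lebesgue_measure R).
Notation leb := (@lebesgue_measure R).
Implicit Types (P : {poly R[i]}) (A : set (circle R)) (a b : R[i]).

Definition wave (c s : R) (m : nat) (t : R) : R :=
  c * cos (m%:R * t) + s * sin (m%:R * t).

(** Real part of a conj(b). *)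
Definition re_conj a b : R := complex.Re a * complex.Re b + complex.Im a * complex.Im b.
(** Imaginary part of conj(a) b, that is, minus that of a conj(b). *)
Definition im_conj a b : R := complex.Re a * complex.Im b - complex.Im a * complex.Re b.

(** The real part of a_j conj(a_k) e^(i(j-k)t), where a_k are the coefficients of
    P, as a wave of nonnegative frequency; the sign accounts for j < k. *)
Definition cross P (j k : nat) (t : R) : R :=
  wave (re_conj P`_j P`_k) ((-1) ^+ (j < k)%N * im_conj P`_j P`_k) `|j%:Z - k%:Z|%N t.

Lemma re_im_conj_sqr a b (e : bool) :
  re_conj a b ^+ 2 + ((-1) ^+ e * im_conj a b) ^+ 2 = (Normc.normc a * Normc.normc b) ^+ 2.
Proof.
have normE (z : R[i]) : Normc.normc z ^+ 2 = complex.Re z ^+ 2 + complex.Im z ^+ 2.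
  by case: z => u v; rewrite /Normc.normc sqr_sqrtr// addr_ge0// sqr_ge0.
rewrite [in RHS]exprMn !normE /re_conj /im_conj exprMn -exprM mulnC exprM sqrrN expr1n expr1n.
ring.
Qed.

Lemma wave_diff (c s t : R) (j k : nat) :
  wave c ((-1) ^+ (j < k)%N * s) `|j%:Z - k%:Z|%N t =
  c * cos (j%:R * t - k%:R * t) + s * sin (j%:R * t - k%:R * t).
Proof.
rewrite /wave -mulrBl; case: (ltnP j k) => jk.
  rewrite (_ : `|j%:Z - k%:Z|%N = (k - j)%N); last lia.
  rewrite natrB ?(ltnW jk)// (_ : (j%:R - k%:R) * t = - ((k%:R - j%:R) * t)); last ring.
  by rewrite cosN sinN expr1; ring.
rewrite (_ : `|j%:Z - k%:Z|%N = (j - k)%N); last lia.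
by rewrite natrB// expr0 mul1r.
Qed.

Lemma horner_expi P (N : nat) (t : R) : (size P <= N)%N ->
  Normc.normc P.[val (expi t)] ^+ 2 =
  \sum_(j <- iota 0 N) \sum_(k <- iota 0 N) cross P j k t.
Proof.
move=> sP.
pose p j := complex.Re P`_j * cos (j%:R * t) - complex.Im P`_j * sin (j%:R * t).
pose q j := complex.Re P`_j * sin (j%:R * t) + complex.Im P`_j * cos (j%:R * t).
have -> : P.[val (expi t)] = (\sum_(j <- iota 0 N) p j) +i* (\sum_(j <- iota 0 N) q j).
  rewrite (horner_coef_wide _ sP) /= -(big_mkord xpredT (fun i => P`_i * (cos t +i* sin t) ^+ i)).
  rewrite /index_iota subn0; elim: (iota 0 N) => [|j s IH]; first by rewrite !big_nil.
  rewrite !big_cons IH expi_exp; case E : P`_j => [u v]; rewrite /p /q E /=.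
  by apply/eqP; rewrite eq_complex /=; apply/andP; split; apply/eqP; ring.
rewrite /Normc.normc sqr_sqrtr ?addr_ge0 ?sqr_ge0// !expr2 !mulr_suml -big_split /=.
apply: eq_bigr => j _; rewrite !mulr_sumr -big_split /=; apply: eq_bigr => k _.
rewrite /cross wave_diff cosB sinB /re_conj /im_conj /p /q; ring.
Qed.

Lemma wave_bound (c s : R) m t : `|wave c s m t| <= `|c| + `|s|.
Proof.
rewrite /wave (le_trans (ler_normD _ _))// !normrM.
apply: lerD; rewrite ler_piMr//; first exact: cos_le_norm1.
by rewrite ler_norml sin_geN1 sin_le1.
Qed.

Lemma measurable_wave (c s : R) m : measurable_fun setT (wave c s m).
Proof.
apply: continuous_measurable_fun => x; apply: cvgD; apply: cvgM; try exact: cvg_cst.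
  by apply: continuous_comp; [apply: cvgM; [exact: cvg_cst|exact: cvg_id]|exact: continuous_cos].
by apply: continuous_comp; [apply: cvgM; [exact: cvg_cst|exact: cvg_id]|exact: continuous_sin].
Qed.

Lemma integrable_wave_angles A (c s : R) m : measurable A ->
  cleb.-integrable (angles A) (EFin \o wave c s m).
Proof.
move=> mA; apply: (@integrable_angles _ _ _ (`|c| + `|s|)) => //.
  exact: measurable_wave.
by move=> x; exact: wave_bound.
Qed.

Lemma integrable_wave_itv (x y c s : R) m : leb.-integrable `]x, y] (EFin \o wave c s m).
Proof.
apply: (@integrable_itv _ _ _ _ (`|c| + `|s|)) => //.
  exact: measurable_wave.
by move=> z; exact: wave_bound.
Qed.

Lemma measurable_horner P : measurable_fun setT (fun t : R => Normc.normc P.[val (expi t)] ^+ 2).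
Proof.
rewrite (_ : (fun t => _) = fun t => \sum_(j <- iota 0 (size P)) \sum_(k <- iota 0 (size P)) cross P j k t).
  by apply: measurable_sum => j; apply: measurable_sum => k; exact: measurable_wave.
by apply/funext => t; rewrite (horner_expi t (leqnn _)).
Qed.

Lemma energy_angles A P : measurable A ->
  energy A P = (\int[cleb]_(t in angles A) (Normc.normc P.[val (expi t)] ^+ 2)%:E)%E.
Proof.
move=> mA; pose F (z : circle R) := (Normc.normc P.[val z] ^+ 2)%:E.
have mF : measurable_fun setT F.
  by apply/measurable_EFinP/measurable_circle_fun; exact: measurable_horner.
have F0 z : (0 <= F z)%E by rewrite lee_fin sqr_ge0.
exact: (arc_length_integral mA mF F0).
Qed.

Lemma energyE A P (N : nat) : measurable A -> (size P <= N)%N ->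
  energy A P = (\sum_(j <- iota 0 N) \sum_(k <- iota 0 N)
    \int[cleb]_(t in angles A) cross P j k t)%:E.
Proof.
move=> mA sP; rewrite energy_angles//.
have mAA : measurable (angles A) by exact: measurable_angles.
have [int <-] := @Rintegral_sum2 _ _ _ cleb (iota 0 N) (cross P) (angles A) mAA
  (fun j k => integrable_wave_angles _ _ _ mA).
rewrite /Rintegral fineK; last exact: integrable_fin_num.
by apply: eq_integral => t _; rewrite (horner_expi t sP).
Qed.

(** The largest integral of a wave of amplitude 1 and frequency m over a set of
    measure T within one period, as [wave_gain] shows. *)
Definition gain (T : R) (m : nat) : R :=
  \int[leb]_(x in `]- (T / 2), T / 2]) cos (m%:R * x).

(** The cosines are compared pointwise: for |x| <= T/2 and j <= n, the angle j x
    stays in [-pi, pi], where moving away from 0 decreases the cosine. *)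
Lemma gain_dec (T : R) (n i j : nat) : 0 < T -> n%:R * T <= 2 * pi ->
  (i <= j <= n)%N -> gain T j <= gain T i.
Proof.
move=> T0 nT /andP[ij jn].
have icos m : leb.-integrable `]- (T / 2), T / 2] (EFin \o (fun x => cos (m%:R * x))).
  rewrite (_ : (fun x => _) = wave 1 0 m); first exact: integrable_wave_itv.
  by apply/funext => x; rewrite /wave mul1r mul0r addr0.
apply: le_Rintegral => // x /=; rewrite in_itv/= => /andP[x1 x2].
have xT : `|x| <= T / 2 by rewrite ler_norml; apply/andP; split; lra.
have pi_bound (k : nat) : (k <= n)%N -> `|k%:R * x| <= pi.
  move=> kn; rewrite normrM normr_nat (le_trans (_ : _ <= n%:R * (T / 2)))//; last lra.
  by rewrite ler_pM// ler_nat.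
rewrite ler_cos_abs ?pi_bound//; last exact: leq_trans jn.
by rewrite !normrM !normr_nat ler_wpM2r// ler_nat.
Qed.

(** [bathtub] after extracting amplitude and phase; for m = 0 the wave is the
    constant c <= rho. *)
Lemma wave_gain (A : set (circle R)) (T D c s rho : R) (m : nat) :
  measurable A -> 0 < T -> arc_length A = T%:E -> almost_in_arc A D ->
  m%:R * D <= 2 * pi -> 0 <= rho -> c ^+ 2 + s ^+ 2 = rho ^+ 2 ->
  \int[cleb]_(x in angles A) wave c s m x <= rho * gain T m.
Proof.
move=> mA T0 AT AD mD rho0 csE.
have mAA : measurable (angles A) by exact: measurable_angles.
have crho : c <= rho.
  rewrite (le_trans (ler_norm _))// -(@ler_pXn2r _ 2)// ?nnegrE// real_normK ?num_real//.
  by rewrite -csE lerDl sqr_ge0.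
case: m mD => [_|m mD].
  have -> : gain T 0 = T.
    rewrite /gain (_ : (fun x => _) = fun=> 1); last by apply/funext => x; rewrite mul0r cos0.
    rewrite Rintegral_cst// mul1r /= lebesgue_measure_itv/= lte_fin ifT; last lra.
    by rewrite /=; field.
  rewrite (_ : wave c s 0 = fun=> c); last by apply/funext => x; rewrite /wave mul0r cos0 sin0; ring.
  rewrite Rintegral_cst// (_ : fine _ = T); last by rewrite -[X in fine X]/(arc_length A) AT.
  by rewrite ler_wpM2r// ltW.
have [rho_eq0|rho_neq0] := eqVneq rho 0.
  move: csE; rewrite rho_eq0 expr0n/= => /eqP; rewrite paddr_eq0 ?sqr_ge0// !sqrf_eq0 => /andP[/eqP -> /eqP ->].
  rewrite (_ : wave 0 0 m.+1 = fun=> 0); last by apply/funext => x; rewrite /wave; ring.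
  by rewrite Rintegral_cst// !mul0r.
have [|p [cE sE]] := @phase R (c / rho) (s / rho).
  by rewrite !expr_div_n -mulrDl csE divff// sqrf_eq0.
rewrite (_ : wave c s m.+1 = fun x => rho * cos (m.+1%:R * x - p)); last first.
  by apply/funext => x; rewrite cosB -cE -sE /wave; field.
have icos : cleb.-integrable (angles A) (EFin \o (fun x => cos (m.+1%:R * x - p))).
  apply: (@integrable_angles _ _ _ 1) => //; first exact: measurable_cosZ.
  by move=> x; exact: cos_le_norm1.
by rewrite RintegralZl// ler_wpM2l//; exact: bathtub AD _ mD.
Qed.

(** A translation by pi / m, half a period of the wave, changes its sign but not
    its integral over the circle.  Adding the bound M makes the integrands
    nonnegative. *)
Lemma wave_orthogonal (c s : R) (m : nat) : (0 < m)%N ->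
  \int[cleb]_(x in angles [set: circle R]) wave c s m x = 0.
Proof.
move=> m0; have mR0 : m%:R != 0 :> R by rewrite pnatr_eq0 -lt0n.
pose M := `|c| + `|s|.
have flip x : wave c s m (x + pi / m%:R) = - wave c s m x.
  rewrite /wave mulrDr (_ : m%:R * (pi / m%:R) = pi); last by field.
  by rewrite cosDpi sinDpi; ring.
have per x : wave c s m (x + 2 * pi) = wave c s m x.
  by rewrite /wave cos_nat_period sin_nat_period.
have Mw (e : R) x : `|e| = 1 -> 0 <= M + e * wave c s m x.
  move=> e1; have := wave_bound c s m x; rewrite -/M -(mul1r `|wave _ _ _ _|) -e1 -normrM.
  by rewrite ler_norml => /andP[]; lra.
have mw (e : R) : measurable_fun setT (fun x => (M + e * wave c s m x)%:E).
  apply/measurable_EFinP/measurable_funD => //; apply: measurable_funM => //.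
  exact: measurable_wave.
have setE : angles [set: circle R] = `]- pi, pi]%classic :> set R by rewrite /angles preimage_setT setIT.
have int_pm : (\int[cleb]_(x in angles [set: circle R]) (M + 1 * wave c s m x)%:E =
               \int[cleb]_(x in angles [set: circle R]) (M + -1 * wave c s m x)%:E)%E.
  rewrite setE !completed_integral//; last 4 first.
  - by apply: measurable_funTS; exact: mw.
  - by move=> x _; rewrite lee_fin Mw// normrN1.
  - by apply: measurable_funTS; exact: mw.
  - by move=> x _; rewrite lee_fin Mw// normr1.
  transitivity (\int[leb]_(x in `](- pi + pi / m%:R)%R, (pi + pi / m%:R)%R]) (M + 1 * wave c s m x)%:E)%E.
    rewrite (_ : (pi + pi / m%:R) = - pi + pi / m%:R + 2 * pi); last ring.
    rewrite [RHS](@integral_period _ _ _ (- pi))//.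
    - by congr integral; rewrite (_ : - pi + 2 * pi = pi)//; ring.
    - by move=> x; rewrite lee_fin Mw// normr1.
    - by rewrite mulr_gt0// pi_gt0.
    - by move=> x; rewrite per.
  rewrite -integral_shift_itv//; last by move=> x; rewrite lee_fin Mw// normr1.
  by apply: eq_integral => x _; rewrite flip mulrN mul1r mulN1r.
have mT : measurable (angles [set: circle R]) by exact: measurable_angles.
have iw := integrable_wave_angles c s m (@measurableT _ (circle R)).
have iM : cleb.-integrable (angles [set: circle R]) (EFin \o (fun=> M)).
  apply: (@integrable_angles _ _ _ `|M|) => //.
have /(congr1 fine) := int_pm.
rewrite -2![fine _]/(Rintegral _ _ _).
under eq_Rintegral do rewrite mul1r.
under [in RHS]eq_Rintegral do rewrite mulN1r.
by rewrite RintegralD// RintegralB//; lra.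
Qed.

Lemma energyT P (N : nat) : (size P <= N)%N ->
  energy [set: circle R] P = (\sum_(j <- iota 0 N) Normc.normc P`_j ^+ 2 * (2 * pi))%:E.
Proof.
move=> sP; rewrite (energyE _ sP)//; congr EFin.
rewrite big_seq [RHS]big_seq; apply: eq_bigr => j jN.
rewrite (bigD1_seq j) ?iota_uniq//= big1 => [|k kj]; last first.
  by apply: wave_orthogonal; lia.
rewrite addr0 /cross subrr ltnn.
have -> : (fun t => wave (re_conj P`_j P`_j) ((-1) ^+ false * im_conj P`_j P`_j) `|0%R|%N t) = fun=> Normc.normc P`_j ^+ 2.
  apply/funext => t; rewrite /wave mul0r cos0 sin0 mulr1 mulr0 addr0 /re_conj.
  by case: P`_j => u v; rewrite /Normc.normc sqr_sqrtr ?addr_ge0 ?sqr_ge0//= !expr2.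
rewrite Rintegral_cst; last exact: measurable_angles.
by congr (_ * _); rewrite -[X in fine X]/(arc_length [set: circle R]) arc_lengthT.
Qed.
End Energy.

(** * Comparison of the energies *)

Section Main.
Variable R : realType.
Notation cleb := (@completed_lebesgue_measure R).
Notation leb := (@lebesgue_measure R).
Implicit Types (P : {poly R[i]}) (A : set (circle R)).

Lemma energy_le_gain A P (T D : R) (N : nat) :
  measurable A -> 0 < T -> arc_length A = T%:E -> almost_in_arc A D ->
  0 <= D -> (size P <= N.+1)%N -> N%:R * D <= 2 * pi ->
  (energy A P <= (\sum_(j <- iota 0 N.+1) \sum_(k <- iota 0 N.+1)
    Normc.normc P`_j * Normc.normc P`_k * gain T `|j%:Z - k%:Z|%N)%:E)%E.
Proof.
move=> mA T0 AT AD D0 sP ND; rewrite (energyE mA sP) lee_fin.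
rewrite big_seq [leRHS]big_seq; apply: ler_sum => j; rewrite mem_iota => jN.
rewrite big_seq [leRHS]big_seq; apply: ler_sum => k; rewrite mem_iota => kN.
have normc_ge0 (z : R[i]) : 0 <= Normc.normc z by case: z => u v; exact: sqrtr_ge0.
apply: (wave_gain mA T0 AT AD).
- apply: le_trans ND; rewrite ler_wpM2r// ler_nat; lia.
- by rewrite mulr_ge0.
- exact: re_im_conj_sqr.
Qed.

(** For real coefficients the sine parts vanish, so the
    quadratic form of the gain is the energy over ]-T/2, T/2].  This half-open
    interval is a subset of the angles of the centered arc even when T = 2 pi and
    the two end points coincide on the circle. *)
Lemma gain_le_energy (x : nat -> R) (T : R) (n : nat) : 0 < T <= 2 * pi ->
  ((\sum_(j <- iota 0 n.+1) \sum_(k <- iota 0 n.+1) x j * x k * gain T `|j%:Z - k%:Z|%N)%:E <=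
   energy (centered_arc T) (\poly_(k < n.+1) (x k)%:C))%E.
Proof.
move=> /andP[T0 T2]; set P := \poly_(k < n.+1) _.
have T02 : 0 <= T <= 2 * pi by rewrite ltW.
have sP : (size P <= n.+1)%N by exact: size_poly.
rewrite energy_angles; last exact: measurable_centered_arc.
have crossE j k t : j \in iota 0 n.+1 -> k \in iota 0 n.+1 ->
    cross P j k t = wave (x j * x k) 0 `|j%:Z - k%:Z|%N t.
  rewrite !mem_iota add0n /= => jn kn.
  by rewrite /cross /re_conj /im_conj !coef_poly jn kn /= !mul0r !mulr0 addr0 subrr mulr0.
have sq0 (t : R) : (0 <= (Normc.normc P.[val (expi t)] ^+ 2)%:E)%E by rewrite lee_fin sqr_ge0.
have msq : measurable_fun setT (fun t : R => (Normc.normc P.[val (expi t)] ^+ 2)%:E).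
  by apply/measurable_EFinP; exact: measurable_horner.
pose I := `]- (T / 2), T / 2]%classic : set R.
have mI : measurable I by exact: measurable_itv.
apply: (@le_trans _ _ (\int[cleb]_(t in I) (Normc.normc P.[val (expi t)] ^+ 2)%:E)%E); last first.
  have mIL : measurable (I : set (lebesgueType R)) by exact: borel_lebesgue mI.
  have mC := measurable_angles (measurable_centered_arc T02).
  have msqL : measurable_fun (angles (centered_arc T)) (fun t : lebesgueType R =>
      (Normc.normc P.[val (expi t)] ^+ 2)%:E).
    apply/measurable_EFinP/measurable_funTS/measurable_borel_lebesgue.
    exact: measurable_horner.
  apply: (@ge0_subset_integral _ _ _ cleb _ _ mIL mC _ msqL) => [t _|t]; first exact: sq0.
  rewrite angles_centered_arc// /I /= !in_itv/= => /andP[t1 t2].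
  have t3 : - pi < t by lra.
  have t4 : t <= pi by lra.
  by split; rewrite ?/angle_range /= ?in_itv/= ?t3 ?t4// (ltW t1).
rewrite completed_integral//; last exact: measurable_funTS.
have [int intE] := @Rintegral_sum2 _ _ _ leb (iota 0 n.+1)
  (fun j k => wave (x j * x k) 0 `|j%:Z - k%:Z|%N) I
  mI (fun j k => integrable_wave_itv _ _ _ _ _).
rewrite le_eqVlt; apply/orP; left; apply/eqP.
transitivity (\int[leb]_(t in I) (\sum_(j <- iota 0 n.+1) \sum_(k <- iota 0 n.+1)
  wave (x j * x k) 0 `|j%:Z - k%:Z|%N t))%:E.
  rewrite intE; congr EFin; apply: eq_bigr => j _; apply: eq_bigr => k _.
  rewrite /gain -/I -RintegralZl//.
    by apply: eq_Rintegral => t _; rewrite /wave mul0r addr0.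
  rewrite (_ : _ \o _ = EFin \o wave 1 0 `|j%:Z - k%:Z|%N); first exact: integrable_wave_itv.
  by apply/funext => t; rewrite /= /wave mul1r mul0r addr0.
rewrite /Rintegral fineK; last exact: integrable_fin_num.
apply: eq_integral => t _; rewrite (horner_expi t sP); congr EFin.
rewrite big_seq [RHS]big_seq; apply: eq_bigr => j jn.
by rewrite big_seq [RHS]big_seq; apply: eq_bigr => k kn; rewrite crossE.
Qed.
End Main.

Theorem theorem7p4 (R : realType) (Omega : set (circle R)) (T D : R)
    (n : nat) (P Pstar : {poly R[i]}) (astar : n.+1.-tuple R)
    (mOmega : measurable Omega)
    (T_gt0 : 0 < T)
    (OmegaT : arc_length Omega = T%:E)
    (OmegaD : D = ess_arc_diam Omega)
    (n_ge1 : (1 <= n)%N)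
    (degP : size P = n.+1)
    (nD : n%:R * D <= 2 * pi)
    (perm_astar : perm_eq astar [seq Normc.normc a | a <- P])
    (astar_arranged : arranged n (fun k => astar`_k))
    (PstarE : Pstar = \poly_(k < n.+1) (astar`_k)%:C) :
  (energy Omega P <= energy (centered_arc T) Pstar)%E /\
  concentration Omega P <= concentration (centered_arc T) Pstar.
Proof.
have AD : almost_in_arc Omega D by rewrite OmegaD; exact: ess_arc_diamP.
have TD := arc_length_le_diam mOmega OmegaT AD.
have nT : n%:R * T <= 2 * pi by apply: le_trans nD; rewrite ler_wpM2l.
have T2 : 0 < T <= 2 * pi.
  by rewrite T_gt0 (le_trans _ nT)// ler_peMl ?ler1n// ltW.
have T02 : 0 <= T <= 2 * pi by case/andP: T2 => /ltW -> ->.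
have mI := measurable_centered_arc T02.
have sPstar : (size Pstar <= n.+1)%N by rewrite PstarE size_poly.
pose x k := Normc.normc P`_k; pose y k := astar`_k.
have x_ge0 k : 0 <= x k by rewrite /x; case: (P`_k) => u v; exact: sqrtr_ge0.
have xE : mkseq x n.+1 = [seq Normc.normc a | a <- P].
  by rewrite -[in RHS](mkseq_nth 0 P) degP /mkseq -map_comp.
have yE : mkseq y n.+1 = astar by rewrite -[RHS](mkseq_nth 0) size_tuple.
have pyx : perm_eq (mkseq y n.+1) (mkseq x n.+1) by rewrite xE yE.
have le_energy : (energy Omega P <= energy (centered_arc T) Pstar)%E.
  apply: le_trans (energy_le_gain mOmega T_gt0 OmegaT AD _ _ nD) _.
  - by apply: le_trans TD; exact: ltW.
  - by rewrite degP.
  rewrite PstarE; apply: le_trans (gain_le_energy _ _ T2); rewrite lee_fin.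
  (* The gain is only known to decrease up to n; differences of indices stay in
     that range, so it may be frozen beyond n. *)
  pose G m := gain T (minn m n).
  have G_dec i j : (i <= j)%N -> G j <= G i.
    by move=> ij; apply: gain_dec nT _ => //; lia.
  have GE (z : nat -> R) :
      \sum_(j <- iota 0 n.+1) \sum_(k <- iota 0 n.+1) z j * z k * gain T `|j%:Z - k%:Z|%N =
      \sum_(j <- iota 0 n.+1) \sum_(k <- iota 0 n.+1) z j * z k * G `|j%:Z - k%:Z|%N.
    rewrite big_seq [RHS]big_seq; apply: eq_bigr => j; rewrite mem_iota => jn.
    rewrite big_seq [RHS]big_seq; apply: eq_bigr => k; rewrite mem_iota => kn.
    by rewrite /G (minn_idPl _)//; lia.
  by rewrite !GE; exact: riesz_rearrangement.
split=> //; rewrite /concentration.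
have -> : energy setT Pstar = energy setT P.
  rewrite (energyT sPstar) (energyT (eq_leq degP)); congr EFin.
  rewrite -!mulr_suml; congr (_ * _).
  have -> : \sum_(j <- iota 0 n.+1) Normc.normc P`_j ^+ 2 = \sum_(z <- mkseq x n.+1) z ^+ 2.
    by rewrite big_map.
  rewrite -(perm_big _ pyx) big_map big_seq [RHS]big_seq; apply: eq_bigr => j.
  rewrite mem_iota add0n /= => jn.
  by rewrite PstarE coef_poly jn /Normc.normc /= expr0n addr0 sqrtr_sqr real_normK ?num_real.
rewrite ler_wpM2r//.
  rewrite invr_ge0 (energyT (eq_leq degP)); apply: sumr_ge0 => j _.
  by rewrite mulr_ge0 ?sqr_ge0// mulr_ge0// pi_ge0.
move: le_energy; rewrite (energyE mOmega (eq_leq degP)) (energyE mI sPstar).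
by rewrite lee_fin.
Qed.
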